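(* Let $\omega(x,y,z) = [x, y\circ z]$, where $[u,v]=uv-vu$ and $u\circ v=\tfrac12(uv+vu)$ (the Lie family, $q=\tfrac12$). Then the universal associative envelope $U(A^\omega)$ is isomorphic, as a unital associative algebra, to the down-up algebra $A(0,1,0)$.
   Context: $\mathbb{F}$ is a field of characteristic $0$. $A$ is the 2-dimensional space of $2\times 2$ matrices over $\mathbb{F}$ with zero diagonal, with basis $e_1 = \begin{bmatrix} 0&1\\0&0\end{bmatrix}$, $e_2 = \begin{bmatrix} 0&0\\1&0\end{bmatrix}$; it is closed under triple products $xyz$ of matrices. For a trilinear operation $\omega(x,y,z)$ (a fixed rational linear combination of the six products of $x,y,z$ in all orders), $A^\omega$ denotes the space $A$ with the trilinear operation $\omega$ computed using matrix multiplication. Let $\mathbb{F}\langle a,b\rangle$ be the free unital associative algebra and $\phi\colon A \to \mathbb{F}\langle a,b\rangle$ the linear map with $\phi(e_1)=a$, $\phi(e_2)=b$. The universal associative envelope is $U(A^\omega) = \mathbb{F}\langle a,b\rangle / I$, where $I$ is the two-sided ideal generated by the elements $\omega(\phi(x),\phi(y),\phi(z)) - \phi(\omega(x,y,z))$ for $x,y,z\in\{e_1,e_2\}$. For $\alpha,\beta,\gamma\in\mathbb{F}$, the down-up algebra $A(\alpha,\beta,\gamma)$ is the unital associative $\mathbb{F}$-algebra with generators $a,b$ and relations $b^2a = \alpha bab + \beta ab^2 + \gamma b$ and $ba^2 = \alpha aba + \beta a^2 b + \gamma a$. *)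

(* Defs.v *)
From HB Require Import structures.
From mathcomp Require Import all_boot all_order all_algebra.
From mathcomp Require Import generic_quotient ring_quotient.
From mathcomp Require Import boolp.
From mathcomp Require Import finmap monalg.

Set Implicit Arguments.
Unset Strict Implicit.
Unset Printing Implicit Defensive.

Import GRing.Theory.

Local Open Scope ring_scope.
Local Open Scope quotient_scope.

Section Ideal.
Variables (R : pzRingType) (rels : R -> Prop).

Inductive in_ideal : R -> Prop :=
| in_ideal_gen r of rels r : in_ideal r
| in_ideal0 : in_ideal 0
| in_idealD x y of in_ideal x & in_ideal y : in_ideal (x + y)
| in_idealMl u x of in_ideal x : in_ideal (u * x)
| in_idealMr x u of in_ideal x : in_ideal (x * u).

Definition ideal_gen : {pred R} := fun x => `[< in_ideal x >].

Lemma ideal_genP x : reflect (in_ideal x) (x \in ideal_gen).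
Proof. exact: asboolP. Qed.

Fact ideal_gen_zmod : zmod_closed ideal_gen.
Proof.
split=> [|x y /ideal_genP Ix /ideal_genP Iy]; apply/ideal_genP.
  exact: in_ideal0.
by rewrite -mulN1r; apply/in_idealD/in_idealMl.
Qed.

HB.instance Definition _ := GRing.isZmodClosed.Build R ideal_gen ideal_gen_zmod.

End Ideal.

(* In MathComp an [algType] is nontrivial (1 != 0), so the quotient of an
   algebra by a two-sided ideal carries a proof that the ideal is proper. *)
Definition quot_alg (F : fieldType) (B : algType F) (rels : B -> Prop)
    of ~ in_ideal rels 1 : Type :=
  Quotient.quot (ideal_gen rels).

Section QuotientAlgebra.
Variables (F : fieldType) (B : algType F) (rels : B -> Prop).
Hypothesis rels_proper : ~ in_ideal rels 1.

Local Notation I := (ideal_gen rels).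
Local Notation Q := (quot_alg rels_proper).

HB.instance Definition _ := GRing.Zmodule.on Q.
HB.instance Definition _ := ZmodQuotient.on Q.

Lemma quot_algP (x y : B) :
  \pi_Q x = \pi_Q y <-> in_ideal rels (x - y).
Proof.
split=> [/eqP|/ideal_genP Ixy].
  by rewrite -Quotient.idealrBE => /ideal_genP.
by apply/eqP; rewrite -Quotient.idealrBE.
Qed.

Definition quot_one : Q := \pi_Q 1.
Definition quot_mul (x y : Q) : Q := \pi_Q (repr x * repr y).
Definition quot_scale (c : F) (x : Q) : Q := \pi_Q (c *: repr x).

Lemma quot_reprB (x : B) : in_ideal rels (repr (\pi_Q x) - x).
Proof. by apply/quot_algP; rewrite reprK. Qed.

Lemma quot_piM (x y : B) : \pi_Q (x * y) = quot_mul (\pi_Q x) (\pi_Q y).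
Proof.
apply/esym/quot_algP.
set x' := repr (\pi_Q x); set y' := repr (\pi_Q y).
have ->: x' * y' - x * y = (x' - x) * y' + x * (y' - y).
  by rewrite mulrBl mulrBr addrA subrK.
by apply: in_idealD; [apply: in_idealMr | apply: in_idealMl];
  apply: quot_reprB.
Qed.

Lemma quot_piZ c (x : B) : \pi_Q (c *: x) = quot_scale c (\pi_Q x).
Proof.
apply/esym/quot_algP; rewrite -scalerBr -[_ - _]mul1r scalerAl.
by apply/in_idealMl/quot_reprB.
Qed.

Lemma quot_pi0 : \pi_Q (0 : B) = 0.
Proof. exact: pi_zeror. Qed.

Lemma quot_piD (x y : B) : \pi_Q (x + y) = \pi_Q x + \pi_Q y.
Proof. exact: pi_addr. Qed.

Lemma quot_ind (P : Q -> Prop) : (forall x : B, P (\pi_Q x)) -> forall q, P q.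
Proof. by move=> Ppi q; rewrite -[q]reprK. Qed.

Fact quot_mulA : associative quot_mul.
Proof.
by elim/quot_ind=> x; elim/quot_ind=> y; elim/quot_ind=> z;
  rewrite -!quot_piM mulrA.
Qed.

Fact quot_mul1 : left_id quot_one quot_mul.
Proof. by elim/quot_ind=> x; rewrite -quot_piM mul1r. Qed.

Fact quot_mulr1 : right_id quot_one quot_mul.
Proof. by elim/quot_ind=> x; rewrite -quot_piM mulr1. Qed.

Fact quot_mulDl : left_distributive quot_mul +%R.
Proof.
by elim/quot_ind=> x; elim/quot_ind=> y; elim/quot_ind=> z;
  rewrite -quot_piD -!quot_piM mulrDl quot_piD.
Qed.

Fact quot_mulDr : right_distributive quot_mul +%R.
Proof.
by elim/quot_ind=> x; elim/quot_ind=> y; elim/quot_ind=> z;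
  rewrite -quot_piD -!quot_piM mulrDr quot_piD.
Qed.

Fact quot_one_neq0 : quot_one != 0.
Proof.
apply/eqP; rewrite -quot_pi0 => /quot_algP.
by rewrite subr0; apply: rels_proper.
Qed.

HB.instance Definition _ := GRing.Zmodule_isNzRing.Build Q
  quot_mulA quot_mul1 quot_mulr1 quot_mulDl quot_mulDr quot_one_neq0.

Fact quot_scaleA a b x : quot_scale a (quot_scale b x) = quot_scale (a * b) x.
Proof. by elim/quot_ind: x => x; rewrite -!quot_piZ scalerA. Qed.

Fact quot_scale1 : left_id 1 quot_scale.
Proof. by elim/quot_ind=> x; rewrite -quot_piZ scale1r. Qed.

Fact quot_scaleDr : right_distributive quot_scale +%R.
Proof.
by move=> c; elim/quot_ind=> x; elim/quot_ind=> y;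
  rewrite -quot_piD -!quot_piZ scalerDr quot_piD.
Qed.

Fact quot_scaleDl x : {morph quot_scale^~ x : a b / a + b}.
Proof.
by elim/quot_ind: x => x a b; rewrite -!quot_piZ scalerDl quot_piD.
Qed.

HB.instance Definition _ := GRing.Zmodule_isLmodule.Build F Q
  quot_scaleA quot_scale1 quot_scaleDr quot_scaleDl.

Fact quot_scaleAl (c : F) (x y : Q) : c *: (x * y) = (c *: x) * y.
Proof.
elim/quot_ind: x => x; elim/quot_ind: y => y.
by rewrite /GRing.scale /= /GRing.mul /= -quot_piM -!quot_piZ -quot_piM scalerAl.
Qed.

HB.instance Definition _ := GRing.Lmodule_isLalgebra.Build F Q quot_scaleAl.

Fact quot_scaleAr (c : F) (x y : Q) : c *: (x * y) = x * (c *: y).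
Proof.
elim/quot_ind: x => x; elim/quot_ind: y => y.
by rewrite /GRing.scale /= /GRing.mul /= -quot_piM -!quot_piZ -quot_piM scalerAr.
Qed.

HB.instance Definition _ := GRing.Lalgebra_isAlgebra.Build F Q quot_scaleAr.

End QuotientAlgebra.

Lemma malg_scaleAr (K : monomType) (F : fieldType) (c : F)
  (x y : {malg F[K]}) : c *: (x * y) = x * (c *: y).
Proof.
apply/malgP => k; rewrite mcoeffZ (mcoeffMl x y k).
rewrite (mcoeffMlw k (fsubset_refl (msupp x)) (msuppZ_le c y)) mulr_sumr.
apply: eq_bigr => i _; rewrite mulr_sumr.
by apply: eq_bigr => j _; rewrite mcoeffZ mulrnAr mulrCA.
Qed.

Definition free2 (F : fieldType) : Type := {malg F[{fmonom 'I_2}]}.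

Section FreeAlgebra.
Variable F : fieldType.

HB.instance Definition _ := GRing.Lalgebra.on (free2 F).

Fact free2_scaleAr (c : F) (x y : free2 F) : c *: (x * y) = x * (c *: y).
Proof. exact: malg_scaleAr. Qed.

HB.instance Definition _ :=
  GRing.Lalgebra_isAlgebra.Build F (free2 F) free2_scaleAr.

Definition free_a : free2 F := mkmalgU (fmu (0 : 'I_2)) 1.
Definition free_b : free2 F := mkmalgU (fmu (1 : 'I_2)) 1.

Definition augmentation : free2 F -> F :=
  mcoeff (one : {fmonom 'I_2}).

Fact augmentation_zmod : zmod_morphism augmentation.
Proof. exact: (@raddfB _ _ (mcoeff (one : {fmonom 'I_2}))). Qed.

Fact augmentation_monoid : monoid_morphism augmentation.
Proof. by split; [exact: rmorph1 | exact: (@rmorphM _ _ (mcoeff _))]. Qed.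

Fact augmentation_scalable : scalable_for *%R augmentation.
Proof. by move=> c x; apply: mcoeffZ. Qed.

HB.instance Definition _ :=
  GRing.isZmodMorphism.Build (free2 F) F augmentation augmentation_zmod.
HB.instance Definition _ :=
  GRing.isMonoidMorphism.Build (free2 F) F augmentation augmentation_monoid.

Lemma augmentation_gen (i : 'I_2) :
  augmentation (mkmalgU (fmu i) 1 : {malg F[{fmonom 'I_2}]}) = 0.
Proof.
rewrite /augmentation mcoeffU; case: eqP => //.
by move=> /(congr1 (@fmonom_val _)); rewrite fmuE /one /= fmoneE.
Qed.

Lemma augmentation_a : augmentation free_a = 0.
Proof. exact: augmentation_gen. Qed.

Lemma augmentation_b : augmentation free_b = 0.
Proof. exact: augmentation_gen. Qed.

Lemma augmentation_proper (rels : free2 F -> Prop) :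
  (forall r, rels r -> augmentation r = 0) -> ~ in_ideal rels 1.
Proof.
move=> rels0 I1.
have: augmentation 1 = 0; last first.
  by rewrite rmorph1 => /eqP; rewrite oner_eq0.
elim: I1 => [r /rels0 //||x y _ x0 _ y0|u x _ x0|x u _ x0].
- by rewrite rmorph0.
- by rewrite rmorphD /= x0 y0 addr0.
- by rewrite rmorphM /= x0 mulr0.
- by rewrite rmorphM /= x0 mul0r.
Qed.

End FreeAlgebra.

(* An operation that makes sense in every associative algebra and is given by
   one and the same rational combination of the six products in all of them. *)
Record trilinear_op (F : fieldType) := TrilinearOp {
  triop :> forall B : algType F, B -> B -> B -> B;
  triopP : exists c1 c2 c3 c4 c5 c6 : rat, forall (B : algType F) (x y z : B),
    triop x y z =
      ratr c1 *: (x * y * z) + ratr c2 *: (x * z * y) +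
      ratr c3 *: (y * x * z) + ratr c4 *: (y * z * x) +
      ratr c5 *: (z * x * y) + ratr c6 *: (z * y * x) }.

(* Generic facts, stated over an abstract algebra: unification in the concrete
   [free2 F] tends to unfold the monoid algebra operations. *)
Section AbstractAugmentation.
Variables (F : fieldType) (B : algType F) (eps : {rmorphism B -> F}).
Hypothesis epsZ : scalable_for *%R eps.

Lemma eps0_lin c d x y : eps x = 0 -> eps y = 0 -> eps (c *: x + d *: y) = 0.
Proof. by move=> x0 y0; rewrite rmorphD /= !epsZ x0 y0 !mulr0 addr0. Qed.

Lemma eps0_sub x y : eps x = 0 -> eps y = 0 -> eps (x - y) = 0.
Proof. by move=> x0 y0; rewrite rmorphB /= x0 y0 subr0. Qed.

Lemma eps0_triop (w : trilinear_op F) x y z :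
  eps x = 0 -> eps y = 0 -> eps z = 0 -> eps (w B x y z) = 0.
Proof.
have [c1 [c2 [c3 [c4 [c5 [c6 wE]]]]]] := triopP w; rewrite wE.
move=> x0 y0 z0; rewrite !rmorphD /= !epsZ !rmorphM /= x0 y0 z0.
by rewrite !mulr0 !addr0.
Qed.

Lemma eps0_down_up alpha beta gamma (u v : B) : eps u = 0 -> eps v = 0 ->
  (eps (v ^+ 2 * u - (alpha *: (v * u * v) + beta *: (u * v ^+ 2) + gamma *: v))
     = 0) *
  (eps (v * u ^+ 2 - (alpha *: (u * v * u) + beta *: (u ^+ 2 * v) + gamma *: u))
     = 0).
Proof.
move=> u0 v0; rewrite !rmorphB !rmorphD /= !epsZ !rmorphM /= u0 v0.
by rewrite !mul0r !mulr0 !addr0 subr0.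
Qed.

End AbstractAugmentation.

Section OffDiagonal.
Variable F : fieldType.

Definition zero_diag : {pred 'M[F]_2} := fun x => [forall i, x i i == 0].

Fact zero_diag_submod : subsemimod_closed zero_diag.
Proof.
split; first split=> [|x y /forallP x0 /forallP y0].
- by apply/forallP => i; rewrite mxE.
- by apply/forallP => i; rewrite mxE (eqP (x0 i)) (eqP (y0 i)) addr0.
- move=> c x /forallP x0; apply/forallP => i.
  by rewrite mxE (eqP (x0 i)) mulr0.
Qed.

Record offdiag := OffDiag { offdiag_mx :> 'M[F]_2; _ : zero_diag offdiag_mx }.

HB.instance Definition _ := [isSub for offdiag_mx].
HB.instance Definition _ := [Choice of offdiag by <:].
HB.instance Definition _ :=
  GRing.SubChoice_isSubLmodule.Build F 'M[F]_2 zero_diag offdiag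
    zero_diag_submod.

Fact e1_zero_diag : zero_diag (delta_mx 0 1).
Proof. by apply/forallP => i; rewrite mxE; case: i => [[|[|]]]. Qed.
Fact e2_zero_diag : zero_diag (delta_mx 1 0).
Proof. by apply/forallP => i; rewrite mxE; case: i => [[|[|]]]. Qed.

Definition e1 : offdiag := OffDiag e1_zero_diag.
Definition e2 : offdiag := OffDiag e2_zero_diag.

Lemma offdiag_diag (x : offdiag) i : offdiag_mx x i i = 0.
Proof. by case: x => x /= /forallP/(_ i)/eqP. Qed.

Lemma ord2_cases (i : 'I_2) : i = 0 \/ i = 1.
Proof. by case: i => [[|[|]]] // hi; [left | right]; apply: val_inj. Qed.

Lemma offdiagE (x : offdiag) : x = x 0 1 *: e1 + x 1 0 *: e2.
Proof.
apply/val_inj/matrixP => i j; rewrite /= !mxE.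
by have [->|->] := ord2_cases i; have [->|->] := ord2_cases j;
  rewrite ?offdiag_diag /= ?mulr1 ?mulr0 ?addr0 ?add0r.
Qed.

Lemma mulmx2E (A B : 'M[F]_2) i j :
  (A * B) i j = A i 0 * B 0 j + A i 1 * B 1 j.
Proof.
rewrite [LHS]mxE big_ord_recl big_ord1.
by rewrite (_ : lift ord0 ord0 = 1) //; apply: val_inj.
Qed.

Fact zero_diagM3 (x y z : offdiag) :
  zero_diag (offdiag_mx x * offdiag_mx y * offdiag_mx z).
Proof.
apply/forallP => i; rewrite !mulmx2E !offdiag_diag.
by have [->|->] := ord2_cases i;
  rewrite !offdiag_diag !(mulr0, mul0r, add0r, addr0).
Qed.

Fact triop_zero_diag (w : trilinear_op F) (x y z : offdiag) :
  zero_diag (w 'M[F]_2 x y z).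
Proof.
have [c1 [c2 [c3 [c4 [c5 [c6 wE]]]]]] := triopP w; rewrite wE.
have [[_ addP] scaleP] := zero_diag_submod.
have zDM c u v t s : zero_diag s ->
  zero_diag (s + c *: (offdiag_mx u * offdiag_mx v * offdiag_mx t)).
  by move=> s0; apply: addP => //; apply/scaleP/zero_diagM3.
by do 5 apply/zDM; apply/scaleP/zero_diagM3.
Qed.

Definition triop_offdiag (w : trilinear_op F) (x y z : offdiag) : offdiag :=
  OffDiag (triop_zero_diag w x y z).

Lemma offdiag_linE c (x y : offdiag) i j :
  offdiag_mx (c *: x + y) i j = c * x i j + y i j.
Proof. by rewrite mxE mxE. Qed.

Lemma offdiag_coord_linear (V : lmodType F) (u v : V) :
  linear (fun x : offdiag => x 0 1 *: u + x 1 0 *: v).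
Proof.
move=> c x y; rewrite !offdiag_linE !scalerDl scalerDr !scalerA.
exact: addrACA.
Qed.

Lemma offdiag_coord_e (V : lmodType F) (u v : V) :
  (e1 0 1 *: u + e1 1 0 *: v = u) * (e2 0 1 *: u + e2 1 0 *: v = v).
Proof. by rewrite /= !mxE /= !scale1r !scale0r addr0 add0r. Qed.

Definition phi (x : offdiag) : free2 F :=
  x 0 1 *: free_a F + x 1 0 *: free_b F.

Fact phi_linear : linear phi.
Proof. exact: offdiag_coord_linear. Qed.

HB.instance Definition _ :=
  GRing.isLinear.Build F offdiag (free2 F) *:%R phi phi_linear.

Lemma phi_e1 : phi e1 = free_a F.
Proof. exact: (offdiag_coord_e _ _).1. Qed.

Lemma phi_e2 : phi e2 = free_b F.
Proof. exact: (offdiag_coord_e _ _).2. Qed.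

Definition envelope_rels (w : trilinear_op F) (r : free2 F) : Prop :=
  exists x y z : offdiag,
    [/\ x \in [:: e1; e2], y \in [:: e1; e2], z \in [:: e1; e2] &
        r = w (free2 F) (phi x) (phi y) (phi z)
            - phi (triop_offdiag w x y z)].

Lemma augmentation_phi x : augmentation (phi x) = 0.
Proof.
exact: (eps0_lin (@augmentation_scalable F) _ _
          (augmentation_a F) (augmentation_b F)).
Qed.

Fact envelope_proper (w : trilinear_op F) : ~ in_ideal (envelope_rels w) 1.
Proof.
apply: augmentation_proper => _ [x [y [z [_ _ _ ->]]]].
by apply: eps0_sub; last exact: augmentation_phi;
  apply: (eps0_triop (@augmentation_scalable F)); apply: augmentation_phi.
Qed.

Definition envelope (w : trilinear_op F) : algType F :=
  quot_alg (@envelope_proper w).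

End OffDiagonal.

Section DownUp.
Variables (F : fieldType) (alpha beta gamma : F).
Local Notation a := (free_a F).
Local Notation b := (free_b F).

Definition down_up_rels (r : free2 F) : Prop :=
     r = b ^+ 2 * a - (alpha *: (b * a * b) + beta *: (a * b ^+ 2) + gamma *: b)
  \/ r = b * a ^+ 2 - (alpha *: (a * b * a) + beta *: (a ^+ 2 * b) + gamma *: a).

Fact down_up_proper : ~ in_ideal down_up_rels 1.
Proof.
have D := eps0_down_up (@augmentation_scalable F) alpha beta gamma
  (augmentation_a F) (augmentation_b F).
by apply: augmentation_proper => r [] ->; [apply: D.1 | apply: D.2].
Qed.

Definition down_up : algType F := quot_alg down_up_proper.

End DownUp.

Section LieFamily.
Variable F : fieldType.

Definition commutator (B : algType F) (u v : B) : B := u * v - v * u.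
Definition jordan (B : algType F) (u v : B) : B := 2^-1 *: (u * v + v * u).

Fact lie_op_subproof : exists c1 c2 c3 c4 c5 c6 : rat,
  forall (B : algType F) (x y z : B),
    commutator x (jordan y z) =
      ratr c1 *: (x * y * z) + ratr c2 *: (x * z * y) +
      ratr c3 *: (y * x * z) + ratr c4 *: (y * z * x) +
      ratr c5 *: (z * x * y) + ratr c6 *: (z * y * x).
Proof.
have ratr_half : ratr (2^-1) = 2^-1 :> F.
  by rewrite /ratr (_ : numq 2^-1 = 1) // (_ : denq 2^-1 = 2) // mul1r.
have ratr_nhalf : ratr (- 2^-1) = - 2^-1 :> F.
  by rewrite /ratr (_ : numq _ = -1) // (_ : denq _ = 2) // mulN1r.
exists 2^-1, 2^-1, 0, (- 2^-1), 0, (- 2^-1) => B x y z.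
rewrite ratr_half ratr_nhalf (_ : ratr 0 = 0); last by rewrite /ratr mul0r.
rewrite /commutator /jordan -scalerAr -scalerAl mulrDr mulrDl !scalerDr.
by rewrite !scale0r !addr0 !scaleNr opprD !mulrA addrA.
Qed.

Definition lie_op : trilinear_op F := TrilinearOp lie_op_subproof.

End LieFamily.

(* Main.v *)
(* For off-diagonal 2x2 matrices y and z, the Jordan product of y and z is a
   scalar matrix, so that omega vanishes identically on A. The ideal defining
   the envelope is therefore generated by the elements [x, y o z] with x, y, z
   in {a, b}; up to invertible scalars these are 0, b^2 a - a b^2 and
   b a^2 - a^2 b, which are exactly the relators of A(0, 1, 0). *)
From HB Require Import structures.
Require Import Defs.
From mathcomp Require Import all_boot all_order all_algebra.
From mathcomp Require Import generic_quotient ring_quotient.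

Set Implicit Arguments.
Unset Strict Implicit.
Unset Printing Implicit Defensive.

Import GRing.Theory.
Local Open Scope ring_scope.
Local Open Scope quotient_scope.

Lemma in_ideal_sub (R : pzRingType) (r1 r2 : R -> Prop) :
  (forall x, r1 x -> in_ideal r2 x) -> forall x, in_ideal r1 x -> in_ideal r2 x.
Proof.
move=> r12 x; elim=> [y /r12 //||y z _ Iy _ Iz|u y _ Iy|y u _ Iy].
- exact: in_ideal0.
- exact: in_idealD.
- exact: in_idealMl.
- exact: in_idealMr.
Qed.

Lemma in_idealZ (F : fieldType) (B : algType F) (rels : B -> Prop) c x :
  in_ideal rels x -> in_ideal rels (c *: x).
Proof. by move=> Ix; rewrite -[x]mul1r scalerAl; apply: in_idealMl. Qed.

Lemma in_idealN (R : pzRingType) (rels : R -> Prop) x :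
  in_ideal rels x -> in_ideal rels (- x).
Proof. by move=> Ix; rewrite -mulN1r; apply: in_idealMl. Qed.

Lemma quot_piB (F : fieldType) (B : algType F) (rels : B -> Prop)
    (p : ~ in_ideal rels 1) (x y : B) :
  \pi_(quot_alg p) (x - y) = \pi_(quot_alg p) x - \pi_(quot_alg p) y.
Proof.
by apply/(addIr (\pi_(quot_alg p) y)); rewrite subrK -quot_piD subrK.
Qed.

Section QuotientIso.
Variables (F : fieldType) (B : algType F) (r1 r2 : B -> Prop).
Hypotheses (p1 : ~ in_ideal r1 1) (p2 : ~ in_ideal r2 1).
Local Notation Q1 := (quot_alg p1).
Local Notation Q2 := (quot_alg p2).

(** Sending a class to that of its chosen representative gives a total function for any two sets of
    relators; it is the canonical map once the first ideal lies in the second. *)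
Definition quot_alg_map (x : Q1) : Q2 := \pi_Q2 (repr x).

Hypothesis r12 : forall x, in_ideal r1 x -> in_ideal r2 x.

Lemma quot_alg_map_pi x : quot_alg_map (\pi_Q1 x) = \pi_Q2 x.
Proof. by apply/quot_algP/r12/quot_reprB. Qed.

Fact quot_alg_map_zmod : zmod_morphism quot_alg_map.
Proof.
elim/quot_ind=> x; elim/quot_ind=> y.
by rewrite -quot_piB !quot_alg_map_pi quot_piB.
Qed.

Fact quot_alg_map_monoid : monoid_morphism quot_alg_map.
Proof.
split; first exact: quot_alg_map_pi.
elim/quot_ind=> x; elim/quot_ind=> y.
(* [quot_piM] speaks of [quot_mul], which agrees with the ring product of the quotient by conversion
   only. *)
rewrite [_ * _ in LHS](_ : _ = \pi_Q1 (x * y)); last exact/esym/quot_piM.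
by rewrite !quot_alg_map_pi quot_piM.
Qed.

Fact quot_alg_map_scalable : scalable quot_alg_map.
Proof.
move=> c; elim/quot_ind=> x.
rewrite [_ *: _ in LHS](_ : _ = \pi_Q1 (c *: x)); last exact/esym/quot_piZ.
by rewrite !quot_alg_map_pi quot_piZ.
Qed.

End QuotientIso.

Lemma quot_alg_mapK (F : fieldType) (B : algType F) (r1 r2 : B -> Prop)
    (p1 : ~ in_ideal r1 1) (p2 : ~ in_ideal r2 1) :
  (forall x, in_ideal r1 x -> in_ideal r2 x) ->
  (forall x, in_ideal r2 x -> in_ideal r1 x) ->
  cancel (@quot_alg_map F B r1 r2 p1 p2) (@quot_alg_map F B r2 r1 p2 p1).
Proof.
move=> r12 r21; elim/quot_ind=> x.
by rewrite (quot_alg_map_pi _ _ r12) (quot_alg_map_pi _ _ r21).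
Qed.

(** Two sets of relators with the same ideal still give distinct quotient types; the canonical maps
    in the two directions are inverse to each other. *)
Lemma quot_alg_iso (F : fieldType) (B : algType F) (r1 r2 : B -> Prop)
    (p1 : ~ in_ideal r1 1) (p2 : ~ in_ideal r2 1) :
  (forall x, in_ideal r1 x <-> in_ideal r2 x) ->
  exists f : {lrmorphism quot_alg p1 -> quot_alg p2}, bijective f.
Proof.
move=> r12.
have s12 x : in_ideal r1 x -> in_ideal r2 x by move/r12.
have s21 x : in_ideal r2 x -> in_ideal r1 x by move/r12.
(* The morphism laws depend on the inclusion [s12], so the structure is packed locally. *)
pose zmodM := GRing.isZmodMorphism.Build _ _ _
  (@quot_alg_map_zmod F B r1 r2 p1 p2 s12).
pose monoidM := GRing.isMonoidMorphism.Build _ _ _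
  (@quot_alg_map_monoid F B r1 r2 p1 p2 s12).
pose scaleM := GRing.isScalable.Build _ _ _ _ _
  (@quot_alg_map_scalable F B r1 r2 p1 p2 s12).
pose f : {lrmorphism quot_alg p1 -> quot_alg p2} :=
  HB.pack (@quot_alg_map F B r1 r2 p1 p2) zmodM monoidM scaleM.
by exists f; exists (@quot_alg_map F B r2 r1 p2 p1); apply: quot_alg_mapK.
Qed.

Section LieRelations.
Variables (F : fieldType) (B : algType F).
Implicit Types u v w : B.

Lemma jordanC u v : jordan u v = jordan v u.
Proof. by rewrite /jordan addrC. Qed.

(** Once 2 is invertible, the Jordan square of [v] is [v ^+ 2]. *)
Lemma commutator_jordan_diag u v : 2 != 0 :> F ->
  commutator u (jordan v v) = u * v ^+ 2 - v ^+ 2 * u.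
Proof.
move=> two_neq0; rewrite /jordan -expr2 -mulr2n -scaler_nat scalerA mulVf //.
by rewrite scale1r.
Qed.

(** The two terms [u * v * u] cancel in the expansion. *)
Lemma commutator_jordan_self u v :
  commutator u (jordan u v) = - (2^-1 *: (v * u ^+ 2 - u ^+ 2 * v)).
Proof.
rewrite /commutator /jordan -scalerAr -scalerAl -scalerBr -scalerN.
by rewrite mulrDr mulrDl opprB !expr2 !mulrA opprD addrA addrK.
Qed.

(** With two letters for three places, either [y = z] or [x] is one of [y] and [z]; symmetry of the
    Jordan product reduces the latter case to [x = y]. *)
Lemma in_ideal_lie (rels : B -> Prop) (a b : B) : 2 != 0 :> F ->
  in_ideal rels (b ^+ 2 * a - a * b ^+ 2) ->
  in_ideal rels (b * a ^+ 2 - a ^+ 2 * b) ->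
  {in [:: a; b] & &, forall x y z, in_ideal rels (commutator x (jordan y z))}.
Proof.
move=> two_neq0 Ibba Ibaa.
have Iabb : in_ideal rels (a * b ^+ 2 - b ^+ 2 * a).
  by rewrite -opprB; apply: in_idealN.
have I_self u v : in_ideal rels (v * u ^+ 2 - u ^+ 2 * v) ->
    in_ideal rels (commutator u (jordan u v)).
  by move=> Iuv; rewrite commutator_jordan_self; apply/in_idealN/in_idealZ.
have I0 u : in_ideal rels (commutator u (jordan u u)).
  by apply: I_self; rewrite -exprS -exprSr subrr; apply: in_ideal0.
move=> x y z; rewrite !inE => /orP[]/eqP-> /orP[]/eqP-> /orP[]/eqP->.
- exact: I0.
- exact: I_self.
- by rewrite jordanC; apply: I_self.
- by rewrite commutator_jordan_diag.
- by rewrite commutator_jordan_diag.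
- by rewrite jordanC; apply: I_self.
- exact: I_self.
- exact: I0.
Qed.

(** Both signs are kept: the down-up relator in [b ^+ 2] is minus [a, b o b], while the one in
    [a ^+ 2] is [b, a o a] itself. *)
Lemma in_ideal_commutator_diag (rels : B -> Prop) u v : 2 != 0 :> F ->
  in_ideal rels (commutator u (jordan v v)) ->
  in_ideal rels (u * v ^+ 2 - v ^+ 2 * u) /\
  in_ideal rels (v ^+ 2 * u - u * v ^+ 2).
Proof.
move=> two_neq0; rewrite commutator_jordan_diag // => Iuv; split=> //.
by rewrite -opprB; apply: in_idealN.
Qed.

Lemma down_up_relator010 u v w t : t - (0 *: u + 1 *: v + 0 *: w) = t - v.
Proof. by rewrite !scale0r scale1r add0r addr0. Qed.

End LieRelations.

(** The products [y * z] and [z * y] are diagonal with the same two entries in opposite order, so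
    their sum is scalar. *)
Lemma jordan_offdiag (F : fieldType) (y z : offdiag F) :
  jordan (y : 'M[F]_2) z = (2^-1 * (y 0 1 * z 1 0 + y 1 0 * z 0 1))%:M.
Proof.
apply/matrixP => i j; rewrite /jordan [LHS]mxE [X in _ * X = _]mxE !mulmx2E mxE.
by have [->|->] := ord2_cases i; have [->|->] := ord2_cases j;
  rewrite !offdiag_diag !(mul0r, mulr0, add0r, addr0) //= ?mulr1n ?mulr0n //;
  rewrite ?(mulrC (z _ _)) // addrC.
Qed.

Lemma lie_op_offdiag (F : fieldType) (x y z : offdiag F) :
  triop_offdiag (lie_op F) x y z = 0.
Proof.
apply/val_inj; rewrite /= /commutator jordan_offdiag.
by apply/eqP; rewrite subr_eq0; apply/eqP; exact: scalar_mxC.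
Qed.

Lemma down_up_rels010 (F : fieldType) (r : free2 F) :
  down_up_rels 0 1 0 r <->
     r = free_b F ^+ 2 * free_a F - free_a F * free_b F ^+ 2
  \/ r = free_b F * free_a F ^+ 2 - free_a F ^+ 2 * free_b F.
Proof.
by split=> -[->|->]; [left | right | left | right];
  first [exact: down_up_relator010 | exact/esym/down_up_relator010].
Qed.

(** This removes the matrices: the subtracted term is [phi 0], and [phi] carries the basis to the
    free generators. *)
Lemma envelope_relsE (F : fieldType) (r : free2 F) :
  envelope_rels (lie_op F) r <->
  exists x y z : free2 F,
    [/\ x \in [:: free_a F; free_b F], y \in [:: free_a F; free_b F],
        z \in [:: free_a F; free_b F] & r = commutator x (jordan y z)].
Proof.
have rE x y z : lie_op F (free2 F) (phi x) (phi y) (phi z)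
    - phi (triop_offdiag (lie_op F) x y z)
    = commutator (phi x) (jordan (phi y) (phi z)).
  have phi0 : phi 0 = 0 :> free2 F by exact: raddf0.
  by rewrite lie_op_offdiag phi0; exact: subr0.
split=> [[x [y [z [xe ye ze ->]]]]|[x [y [z [xe ye ze ->]]]]].
  exists (phi x), (phi y), (phi z).
  rewrite rE -phi_e1 -phi_e2.
  have phi_mem u : u \in [:: e1 F; e2 F] ->
    phi u \in [:: phi (e1 F); phi (e2 F)].
    exact: (map_f (@phi F)).
  by split=> //; apply: phi_mem.
have phi_lift u : u \in [:: free_a F; free_b F] ->
    exists2 t, t \in [:: e1 F; e2 F] & u = phi t.
  by rewrite -phi_e1 -phi_e2 => /(mapP (s := [:: e1 F; e2 F])).
have [t xt ->] := phi_lift _ xe; have [t' yt ->] := phi_lift _ ye.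
have [t'' zt ->] := phi_lift _ ze.
by exists t, t', t''; rewrite rE.
Qed.

Theorem lemma4p22 (F : fieldType) (F_char0 : [pchar F] =i pred0) :
  exists f : {lrmorphism envelope (lie_op F) -> down_up (0 : F) 1 0},
    bijective f.
Proof.
have two_neq0 : 2 != 0 :> F by have := F_char0 2%N; rewrite inE /= => /negbT.
apply: quot_alg_iso => x; split; apply: in_ideal_sub => {x} r.
  move=> /envelope_relsE[x [y [z [xe ye ze ->]]]].
  by apply: (in_ideal_lie (a := free_a F) (b := free_b F)) => //;
    apply/in_ideal_gen/down_up_rels010; [left | right].
(* For the reverse inclusion, the envelope generators with equal last two arguments already yield
   both down-up relators. *)
have I_lie x y :
    x \in [:: free_a F; free_b F] -> y \in [:: free_a F; free_b F] ->
    in_ideal (envelope_rels (lie_op F)) (commutator x (jordan y y)).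
  by move=> xe ye; apply/in_ideal_gen/envelope_relsE; exists x, y, y.
have ae : free_a F \in [:: free_a F; free_b F] by exact: mem_head.
have be : free_b F \in [:: free_a F; free_b F].
  exact: (mem_last _ [:: free_b F]).
move=> /down_up_rels010[->|->].
  exact: (in_ideal_commutator_diag two_neq0 (I_lie _ _ ae be)).2.
exact: (in_ideal_commutator_diag two_neq0 (I_lie _ _ be ae)).1.
Qed.
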